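(* Let $A=\{a_1,\dots,a_K\}$ be a finite set of items, let $\mathcal{F}$ be an antimonotonic family of itemsets over $A$, and let $C\subseteq A$ be a set that is not safe. Then there exist a query function $f$ depending only on $C$ and frequencies $\theta$ for $\mathcal{F}$ such that the minimum value of Problem P is strictly larger than the minimum value of Problem P$_C$.
   Context: An itemset is a subset $U\subseteq A$ with indicator $S_U:\{0,1\}^K\to\{0,1\}$, $S_U(z)=1$ iff $z_i=1$ for all $a_i\in U$. $\mathcal{F}$ is antimonotonic if it is closed under taking subsets. A distribution $p$ on $\{0,1\}^K$ satisfies $\theta=(\theta_U)_{U\in\mathcal{F}}$ if $E_p[S_U]=\theta_U$ for all $U\in\mathcal{F}$; ''frequencies for $\mathcal{F}$'' means such a $\theta$ satisfied by at least one distribution. For $C\subseteq A$, $\pi_C\mathcal{F}=\{U\in\mathcal{F}:U\subseteq C\}$, $\pi_C\theta=(\theta_U)_{U\in\pi_C\mathcal{F}}$, $\pi_C p$ is the marginal of $p$ on the coordinates in $C$, $p$ is an extension of $q$ if $\pi_Cp=q$, and a distribution $q$ on $\{0,1\}^C$ satisfies $\pi_C\theta$ if $E_q[S_U]=\theta_U$ for $U\in\pi_C\mathcal{F}$. $C$ is safe if for every frequencies $\theta$ for $\mathcal{F}$, every distribution $q$ on $\{0,1\}^C$ satisfying $\pi_C\theta$ has an extension $p$ on $\{0,1\}^K$ satisfying $\theta$. Let $\mathbb{P}$ be the set of all distributions on $\{0,1\}^K$. A query function $f:\mathbb{P}\to\mathbb{R}$ depends only on $C$ if there is a function $f_C$ on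 the set of distributions on $\{0,1\}^C$ with $f(p)=f_C(\pi_Cp)$ for all $p\in\mathbb{P}$. Problem P: minimise $f(p)$ over $p\in\mathbb{P}$ satisfying $\theta$. Problem P$_C$: minimise $f_C(q)$ over distributions $q$ on $\{0,1\}^C$ satisfying $\pi_C\theta$. The minimum value of a problem means the infimum of its objective over its feasible set. *)

(* Defs.v *)
From HB Require Import structures.
From mathcomp Require Import all_boot all_order all_algebra.
From mathcomp Require Import classical_sets reals constructive_ereal ereal.

Set Implicit Arguments.
Unset Strict Implicit.
Unset Printing Implicit Defensive.

Import Order.TTheory GRing.Theory Num.Theory.
Local Open Scope ring_scope.

Record distr (R : realType) (T : finType) := Distr {
  pmf :> {ffun T -> R};
  distr_subproof : [forall x, 0 <= pmf x] && (\sum_x pmf x == 1) }.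

HB.instance Definition _ (R : realType) (T : finType) :=
  [isSub for @pmf R T].
HB.instance Definition _ (R : realType) (T : finType) :=
  [Choice of distr R T by <:].

Definition expectation (R : realType) (T : finType) (p : distr R T)
    (g : T -> R) : R :=
  \sum_x p x * g x.

(* [{0,1}^I]; below, [I] is either ['I_K] or the subtype of items in [C]. *)
Definition binvec (I : finType) := {ffun I -> bool}.

Definition indicator (I : finType) (U : {set I}) (z : binvec I) : bool :=
  [forall i in U, z i].

Definition freq (R : realType) (I : finType) (p : distr R (binvec I))
    (U : {set I}) : R :=
  expectation p (fun z => (indicator U z)%:R).

Definition antimonotonic (K : nat) (F : {set {set 'I_K}}) : Prop :=
  forall U V : {set 'I_K}, U \in F -> V \subset U -> V \in F.

Definition proj_family (K : nat) (C : {set 'I_K}) (F : {set {set 'I_K}}) :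
    {set {set 'I_K}} :=
  [set U in F | U \subset C].

Definition items_in (K : nat) (C : {set 'I_K}) : finType := {i : 'I_K | i \in C}.

Definition restrict (K : nat) (C : {set 'I_K}) (z : binvec 'I_K) :
    binvec (items_in C) :=
  [ffun i => z (val i)].

Definition marginal_pmf (R : realType) (K : nat) (C : {set 'I_K})
    (p : distr R (binvec 'I_K)) : {ffun binvec (items_in C) -> R} :=
  [ffun y => \sum_(z | restrict C z == y) p z].

Lemma marginal_subproof (R : realType) (K : nat) (C : {set 'I_K})
    (p : distr R (binvec 'I_K)) :
  [forall y, 0 <= marginal_pmf C p y] && (\sum_y marginal_pmf C p y == 1).
Proof.
have /andP[/forallP p_ge0 p_sum1] := distr_subproof p.
apply/andP; split.
  by apply/forallP => y; rewrite ffunE sumr_ge0.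
rewrite -(eqP p_sum1) (partition_big (restrict C) xpredT) //=.
by apply/eqP/eq_bigr => y _; rewrite ffunE.
Qed.

Definition marginal (R : realType) (K : nat) (C : {set 'I_K})
    (p : distr R (binvec 'I_K)) : distr R (binvec (items_in C)) :=
  Distr (marginal_subproof C p).

Definition extension (R : realType) (K : nat) (C : {set 'I_K})
    (p : distr R (binvec 'I_K)) (q : distr R (binvec (items_in C))) : Prop :=
  marginal C p = q.

(* A vector [theta] indexed by [F] is encoded by a total function on itemsets
   whose values outside [F] are never used; its projection to [C] is then the
   same function, read on [proj_family C F] only. *)
Definition satisfies (R : realType) (K : nat) (F : {set {set 'I_K}})
    (theta : {set 'I_K} -> R) (p : distr R (binvec 'I_K)) : Prop :=
  forall U : {set 'I_K}, U \in F -> freq p U = theta U.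

(* [val @^-1: U] is [U], a subset of [C], seen as a set of items of the
   subtype. *)
Definition satisfies_proj (R : realType) (K : nat) (F : {set {set 'I_K}})
    (theta : {set 'I_K} -> R) (C : {set 'I_K})
    (q : distr R (binvec (items_in C))) : Prop :=
  forall U : {set 'I_K}, U \in proj_family C F ->
    freq q (val @^-1: U) = theta U.

Definition frequencies (R : realType) (K : nat) (F : {set {set 'I_K}})
    (theta : {set 'I_K} -> R) : Prop :=
  exists p : distr R (binvec 'I_K), satisfies F theta p.

Definition safe (R : realType) (K : nat) (F : {set {set 'I_K}})
    (C : {set 'I_K}) : Prop :=
  forall theta : {set 'I_K} -> R, frequencies F theta ->
  forall q : distr R (binvec (items_in C)), satisfies_proj F theta q ->
  exists p : distr R (binvec 'I_K), extension p q /\ satisfies F theta p.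

(* [f] depends only on [C], with [fC] the function witnessing it; [fC] is
   unique since every distribution on [{0,1}^C] is a marginal. *)
Definition depends_only_on (R : realType) (K : nat) (C : {set 'I_K})
    (f : distr R (binvec 'I_K) -> R)
    (fC : distr R (binvec (items_in C)) -> R) : Prop :=
  forall p : distr R (binvec 'I_K), f p = fC (marginal C p).

Definition min_P (R : realType) (K : nat) (F : {set {set 'I_K}})
    (theta : {set 'I_K} -> R) (f : distr R (binvec 'I_K) -> R) : \bar R :=
  ereal_inf [set (f p)%:E | p in [set p | satisfies F theta p]]%classic.

Definition min_PC (R : realType) (K : nat) (F : {set {set 'I_K}})
    (theta : {set 'I_K} -> R) (C : {set 'I_K})
    (fC : distr R (binvec (items_in C)) -> R) : \bar R :=
  ereal_inf [set (fC q)%:E | q in [set q | satisfies_proj F theta q]]%classic.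

(* Main.v *)
(* An unsafe [C] comes with frequencies [theta] and a distribution [q] on
   [{0,1}^C] that satisfies the projected frequencies but is the marginal of no
   distribution satisfying [theta].  The query that is 0 when the marginal is
   [q] and 1 otherwise reaches 0 in Problem P_C, but is constantly 1 on the
   feasible set of Problem P. *)
Require Import Defs.
From mathcomp Require Import all_boot all_order all_algebra.
From mathcomp Require Import classical_sets reals constructive_ereal ereal.
From mathcomp Require Import boolp.

Import Order.TTheory Num.Theory.

(** Classical negation of [safe], with the missing extension of [q] restated as a condition on every
    [p] satisfying [theta]. *)
Lemma unsafe_witness (R : realType) (K : nat) (F : {set {set 'I_K}})
    (C : {set 'I_K}) : ~ safe R F C ->
  exists (theta : {set 'I_K} -> R) (q : distr R (binvec (items_in C))),
    [/\ frequencies F theta, satisfies_proj F theta q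
      & forall p, satisfies F theta p -> marginal C p <> q].
Proof.
move=> C_unsafe; apply: contrapT => no_witness; apply: C_unsafe.
move=> theta theta_freq q q_sat; apply: contrapT => no_ext; apply: no_witness.
exists theta, q; split=> // p p_sat p_ext; apply: no_ext.
by exists p; split.
Qed.

Theorem theorem4 (R : realType) (K : nat) (F : {set {set 'I_K}})
    (F_anti : antimonotonic F) (C : {set 'I_K}) (C_unsafe : ~ safe R F C) :
  exists (f : distr R (binvec 'I_K) -> R)
         (fC : distr R (binvec (items_in C)) -> R)
         (theta : {set 'I_K} -> R),
    [/\ depends_only_on f fC,
        frequencies F theta
      & (min_PC F theta fC < min_P F theta f)%E].
Proof.
have [theta [q [theta_freq q_sat q_noext]]] :=
  unsafe_witness _ _ _ _ C_unsafe.
(* The boolean [!=] is the equality test that [distr] inherits from [pmf]. *)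
pose fC (r : distr R (binvec (items_in C))) : R := (r != q)%:R%R.
exists (fun p => fC (marginal C p)), fC, theta; split=> //.
(* The constants 0 and 1 separate the two infima, which keeps the inequality strict. *)
apply: (@le_lt_trans _ _ 0%:E).
  by apply: ereal_inf_lbound; exists q; rewrite // /fC eqxx.
apply: (@lt_le_trans _ _ 1%:E); first by rewrite lte_fin ltr01.
apply: le_ereal_inf_tmp => _ [p p_sat <-].
(* A feasible [p] with marginal [q] is excluded by [q_noext], so the value is 1. *)
by rewrite /fC; case: eqP => [/(q_noext _ p_sat)|].
Qed.
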